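(* Every finite simple graph $G$ of radius two is universal antimagic orientable: for every set $L$ of $|E(G)|$ distinct positive real numbers, there exist an orientation $D$ of $G$ and a bijection $\tau:E(G)\to L$ such that the vertex sums $s_{(D,\tau)}(v)$, $v\in V(G)$, are pairwise distinct.
   Context: The eccentricity of a vertex $v$ in a connected graph $G$ is the maximum distance from $v$ to a vertex of $G$; the radius of $G$ is the minimum eccentricity over all vertices. For an orientation $D$ of $G$ and labeling $\tau:E(G)\to\mathbb{R}$, the vertex sum $s_{(D,\tau)}(v)$ is the sum of the labels of the edges directed into $v$ minus the sum of the labels of the edges directed out of $v$. $G$ is universal antimagic orientable if for every set $L$ of $|E(G)|$ positive real numbers there exist an orientation $D$ and a bijection $\tau:E(G)\to L$ making all vertex sums pairwise distinct. *)

(* Defs.v *)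
From HB Require Import structures.
From mathcomp Require Import all_boot all_order all_algebra.
From mathcomp Require Import finmap.
From mathcomp Require Import reals.

Set Implicit Arguments.
Unset Strict Implicit.
Unset Printing Implicit Defensive.

Import Order.TTheory GRing.Theory Num.Theory.
Local Open Scope ring_scope.

Record sgraph : Type := SGraph {
  vertex :> finType;
  adj : rel vertex;
  adj_sym : symmetric adj;
  adj_irrefl : irreflexive adj }.

Definition connected (G : sgraph) : Prop :=
  forall x y : G, connect (@adj G) x y.

Definition walk_of_length (G : sgraph) (x y : G) (n : nat) : bool :=
  [exists p : n.-tuple G, path (@adj G) x p && (last x p == y)].

(* Least length of a walk from x to y. A shortest walk has length < #|G|, so
   the search below is exhaustive; the value is #|G| iff y is not reachable
   from x. *)
Definition dist (G : sgraph) (x y : G) : nat :=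
  find (walk_of_length x y) (iota 0 #|G|).

Definition eccentricity (G : sgraph) (x : G) : nat :=
  \max_(y : G) dist x y.

(* Every eccentricity is at most #|G|, so the default value #|G| of the minimum
   is only relevant when G has no vertex. *)
Definition radius (G : sgraph) : nat :=
  \big[minn/#|G|]_(x : G) eccentricity x.

Definition edge_set (G : sgraph) : {set {set G}} :=
  [set [set p.1; p.2] | p : G * G & adj p.1 p.2].

Definition edge (G : sgraph) : finType := {a : {set G} | a \in edge_set G}.

(* The edge a is directed from arc_tail a to arc_head a. *)
Record orientation (G : sgraph) : Type := Orientation {
  arc_tail : edge G -> G;
  arc_head : edge G -> G;
  orientationP : forall a : edge G, val a = [set arc_tail a; arc_head a] }.

Definition vertex_sum (R : realType) (G : sgraph) (D : orientation G)
    (tau : edge G -> R) (v : G) : R :=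
  \sum_(a : edge G | arc_head D a == v) tau a
  - \sum_(a : edge G | arc_tail D a == v) tau a.

Definition universal_antimagic_orientable (R : realType) (G : sgraph) : Prop :=
  forall L : {fset R},
    #|` L|%fset = #|edge_set G| ->
    (forall x : R, x \in L -> 0 < x) ->
    exists (D : orientation G) (tau : edge G -> L),
      bijective tau /\ injective (vertex_sum D (fun a => val (tau a))).

(* Main.v *)
Require Import Defs.
From mathcomp Require Import all_boot all_order all_algebra.
From mathcomp Require Import finmap.
From mathcomp Require Import reals.

Set Implicit Arguments.
Unset Strict Implicit.
Unset Printing Implicit Defensive.

Import Order.TTheory GRing.Theory Num.Theory.
Local Open Scope ring_scope.

(* Let r have maximum degree among the vertices within distance two of all
   others, and call near the neighbours of r and far the vertices at distance
   two. The largest labels go to the star at r, the next ones to the cross edges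
   between near and far vertices, and the smallest to the edges inside the two
   layers. Cross edges point to the far layer and star edges to r, while the
   inner edges can be oriented and labelled so that they contribute at most
   their largest label M, in absolute value, at each vertex. Hence the sums are
   positive on the far layer and negative on the near one. Reserving one cross
   edge per far vertex and handing out the reserved labels in the order of the
   partial sums makes the far sums distinct, and the star edges do the same for
   the near sums. Finally r receives all the star labels, which exceeds the sum
   at every far vertex. *)

(** * Sequences *)

Lemma uniq_map_inj (T1 T2 : eqType) (f : T1 -> T2) (s : seq T1) :
  uniq (map f s) -> {in s &, injective f}.
Proof.
elim: s => //= z s IH /andP[zs us] x y; rewrite !inE.
move=> /orP[/eqP->|xs] /orP[/eqP->|ys] // E; last exact: IH.
  by rewrite E map_f in zs.
by rewrite -E map_f in zs.
Qed.

Lemma split_size (T : Type) (s : seq T) (m n : nat) :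
  size s = (m + n)%N ->
  exists s1 s2, [/\ s = s1 ++ s2, size s1 = m & size s2 = n].
Proof.
move=> sz; exists (take m s), (drop m s).
by rewrite cat_take_drop size_drop size_takel sz ?addKn ?leq_addr.
Qed.

Lemma sorted_nth0 (T : eqType) (e : rel T) (x0 x : T) (s : seq T) :
  reflexive e -> transitive e -> sorted e s -> x \in s -> e (nth x0 s 0) x.
Proof.
move=> e_refl e_tr; case: s => // y s /= /(order_path_min e_tr)/allP le_y.
by rewrite inE => /orP[/eqP->|/le_y].
Qed.

Lemma sorted_cat_nth0 (T : eqType) (e : rel T) (x0 x : T) (s1 s2 : seq T) :
  transitive e -> sorted e (s1 ++ s2) -> x \in s1 -> e x x0 ->
  e x (nth x0 s2 0).
Proof.
move=> e_tr; rewrite (sorted_pairwise e_tr) pairwise_cat.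
move=> /and3P[/allrelP e12 _ _] xs1; case: s2 e12 => // y s2 e12 _.
by apply: e12; rewrite ?mem_head.
Qed.

Lemma sum_zip_index (R : nmodType) (I : Type) (T : eqType) (f : I -> T)
    (s : seq I) (ls : seq R) (v : T) :
  uniq (map f s) -> size ls = size s ->
  \sum_(x <- zip s ls | f x.1 == v) x.2 = ls`_(index v (map f s)).
Proof.
elim: s ls => [|y s IH] [|l ls] //=; first by rewrite big_nil.
move=> /andP[ys us] [sz]; rewrite big_cons /=.
case: eqP => [yv|_]; last exact: IH.
by rewrite IH // nth_default ?addr0 // memNindex -?yv // size_map sz.
Qed.

Lemma injective_relabelling (R : realDomainType) (T : eqType) (s : seq T)
    (ls : seq R) (p : T -> R) :
  uniq s -> uniq ls -> size ls = size s ->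
  exists2 h : T -> R, perm_eq (map h s) ls &
    {in s &, injective (fun v => p v + h v)}.
Proof.
move=> us uls sz.
pose s' := sort (relpre p <=%R) s; pose l' := sort <=%R ls.
pose h v := l'`_(index v s').
have sz' : size l' = size s' by rewrite !size_sort.
have srt : sorted (relpre p <=%R) s'.
  by apply: sort_sorted => x y; apply: le_total.
have ps : perm_eq s s' by rewrite perm_sym perm_sort.
exists h.
  apply: (perm_trans (perm_map h ps)).
  suff -> : map h s' = l' by rewrite perm_sort.
  apply: (@eq_from_nth _ 0); rewrite size_map ?sz' // => i lti.
  case: s' => [//|x0 s''] in ps h sz' srt lti *.
  by rewrite (nth_map x0) // /h index_uniq // -(perm_uniq ps).
have sum_lt v w : v \in s -> w \in s -> (index v s' < index w s')%N ->
    p v + h v < p w + h w.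
  move=> vs ws ltvw; apply: ler_ltD.
    apply: (sorted_ltn_index _ srt); rewrite ?mem_sort //.
    by move=> x y z; apply: le_trans.
  rewrite /h lt_sorted_ltn_nth ?inE ?sz' ?index_mem ?mem_sort //.
  by rewrite sort_lt_sorted.
move=> v w vs ws /= E.
case: (ltngtP (index v s') (index w s')) => [/sum_lt|/sum_lt|].
- by move=> /(_ vs ws); rewrite E ltxx.
- by move=> /(_ ws vs); rewrite E ltxx.
by apply: index_inj; rewrite ?mem_sort.
Qed.

(** * Paths and cycles *)

Lemma set2_inj (T : finType) (x y a b : T) :
  [set x; y] = [set a; b] -> (x = a /\ y = b) \/ (x = b /\ y = a).
Proof.
move=> /setP E; have := E x; have := E y; have := E a; have := E b.
rewrite !inE !eqxx !orbT => /orP[]/eqP-> /orP[]/eqP->.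
all: by move=> /esym/orP[]/eqP + /esym/orP[]/eqP +; by [left | right].
Qed.

Lemma left_maximal_path (V : finType) (e : rel V) (x : V) (p : seq V) :
  uniq (x :: p) -> path e x p -> p != [::] ->
  exists y q, [/\ uniq (y :: q), path e y q, q != [::] &
    forall z, e z y -> z \in y :: q].
Proof.
have [n] := ubnP (#|V| - size p); elim: n => // n IH in x p *.
rewrite ltnS => le_n up pp p0.
have [/existsP[z /andP[ezx zp]]|/existsPn noz] :=
  boolP [exists z, e z x && (z \notin x :: p)].
  apply: (IH z (x :: p)) => //=; rewrite ?ezx ?zp //.
  have: (size (x :: p) <= #|V|)%N by rewrite -(card_uniqP up) max_card.
  by move=> /= ltp; apply: leq_trans (ltn_sub2l ltp (ltnSn _)) le_n.
exists x, p; split=> // z ezx; apply: contraT => zp.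
by have := noz z; rewrite ezx zp.
Qed.

(* A left-maximal path contains all the neighbours of its first vertex. *)
Lemma pendant_or_cycle (V : finType) (e : rel V) (a b : V) :
  symmetric e -> irreflexive e -> e a b ->
  (exists x y, e x y /\ forall z, e x z -> z = y) \/
  (exists c, [/\ uniq c, (2 < size c)%N & cycle e c]).
Proof.
move=> e_sym e_irr eab.
have ab : uniq [:: a; b].
  by rewrite /= inE andbT; apply: contraTneq eab => ->; rewrite e_irr.
have pab : path e a [:: b] by rewrite /= eab.
have [x [[|y q] [uq pq // _ xmax]]] := left_maximal_path ab pab isT.
have exy : e x y by case/andP: pq.
have [/existsP[z /andP[exz zy]]|/existsPn noz] :=
  boolP [exists z, e x z && (z != y)]; last first.
  left; exists x, y; split=> // z exz; apply/eqP.
  by have := noz z; rewrite exz /= negbK.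
right; have ezx : e z x by rewrite e_sym.
have := xmax _ ezx; rewrite !inE (negPf zy) /=.
case/orP => [/eqP zx|zq]; first by rewrite zx e_irr in ezx.
case/splitPr: zq uq pq {xmax} => q1 q2 uq pq.
exists (x :: y :: rcons q1 z); split.
- by move: uq; rewrite -cat_rcons -!cat_cons cat_uniq => /andP[].
- by rewrite /= size_rcons.
rewrite /= rcons_path last_rcons ezx andbT.
by move: pq; rewrite -cat_rcons /= cat_path => /and3P[-> -> _].
Qed.

Definition cycle_edges (V : finType) (c : seq V) : {set {set V}} :=
  [set [set x; next c x] | x in c].

Lemma pendant_edge_or_cycle (V : finType) (F : {set {set V}}) :
  (forall e, e \in F -> #|e| = 2%N) -> F != set0 ->
  (exists x y, [/\ x != y, [set x; y] \in F &
     forall e, e \in F -> x \in e -> e = [set x; y]]) \/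
  (exists c, [/\ uniq c, (2 < size c)%N & cycle_edges c \subset F]).
Proof.
move=> F2 /set0Pn[e0 e0F]; pose e : rel V := fun x y => [set x; y] \in F.
have e_sym : symmetric e by move=> x y; rewrite /e setUC.
have e_irr : irreflexive e.
  by move=> x; apply/negP => /F2; rewrite setUid cards1.
have /cards2P[a [b [_ e0E]]] : #|e0| == 2%N by rewrite F2.
have eab : e a b by rewrite /e -e0E.
have [[x [y [exy x_nbr]]]|[c [uc sc ec]]] := pendant_or_cycle e_sym e_irr eab.
  left; exists x, y; split=> // [|f fF xf].
    by apply: contraTneq exy => ->; rewrite e_irr.
  have /cards2P[u [w [_ fE]]] : #|f| == 2%N by rewrite F2.
  move: xf fF; rewrite fE !inE => /orP[]/eqP<- => [/x_nbr->//|].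
  by rewrite setUC => /x_nbr->.
right; exists c; split=> //.
by apply/subsetP => f /imsetP[x xc ->]; apply: (next_cycle ec xc).
Qed.

Lemma next_next_neq (T : eqType) (c : seq T) (x : T) :
  uniq c -> (2 < size c)%N -> x \in c -> next c (next c x) != x.
Proof.
move=> uc sc xc; have [i c' cE] := rot_to xc.
rewrite -!(next_rot i uc) cE.
have: uniq (rot i c) by rewrite rot_uniq.
have: (2 < size (rot i c))%N by rewrite size_rot.
rewrite cE; case: c' {cE} => [//|y [//|z s]] _ /= /andP[].
rewrite !inE !negb_or eqxx => /and3P[xy xz _] _.
by rewrite [y == x]eq_sym (negPf xy) eqxx eq_sym.
Qed.

Lemma cycle_edge_inj (V : finType) (c : seq V) :
  uniq c -> (2 < size c)%N ->
  {in c &, injective (fun x => [set x; next c x])}.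
Proof.
move=> uc sc x y xc yc /set2_inj[[]//|[xE nE]].
by have := next_next_neq uc sc yc; rewrite -xE nE eqxx.
Qed.

Lemma card_cycle_edges (V : finType) (c : seq V) :
  uniq c -> (2 < size c)%N -> #|cycle_edges c| = size c.
Proof.
move=> uc sc; rewrite card_in_imset ?(card_uniqP uc) //.
exact: cycle_edge_inj.
Qed.

(** * Labelled arcs *)

Local Notation source x := x.1.1.
Local Notation target x := x.1.2.
Local Notation label x := x.2.

Section LabelledArcs.
Variable V : finType.

Definition arc_ends (R : Type) (x : V * V * R) : {set V} :=
  [set source x; target x].

Definition orients (R : Type) (F : {set {set V}}) (T : seq (V * V * R)) :
  bool :=
  perm_eq (map (@arc_ends R) T) (enum F).

Definition oriented_labelling (R : eqType) (F : {set {set V}}) (ls : seq R)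
    (T : seq (V * V * R)) : bool :=
  orients F T && perm_eq [seq label x | x <- T] ls.

Definition directed (R : Type) (A B : {set V}) (T : seq (V * V * R)) : bool :=
  all (fun x => (source x \in A) && (target x \in B)) T.

Definition reverse_arcs (R : Type) (T : seq (V * V * R)) : seq (V * V * R) :=
  [seq (target x, source x, label x) | x <- T].

Definition inflow (R : nmodType) (T : seq (V * V * R)) (v : V) : R :=
  \sum_(x <- T | target x == v) label x.

Definition outflow (R : nmodType) (T : seq (V * V * R)) (v : V) : R :=
  \sum_(x <- T | source x == v) label x.

Definition net_sum (R : zmodType) (T : seq (V * V * R)) (v : V) : R :=
  inflow T v - outflow T v.

Lemma orients_uniq (R : Type) (F : {set {set V}}) (T : seq (V * V * R)) :
  orients F T -> uniq (map (@arc_ends R) T).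
Proof. by move=> oT; rewrite (perm_uniq oT) enum_uniq. Qed.

Lemma arc_ends_mem (R : eqType) (F : {set {set V}}) (T : seq (V * V * R))
    (x : V * V * R) :
  orients F T -> x \in T -> arc_ends x \in F.
Proof. by move=> oT xT; rewrite -mem_enum -(perm_mem oT) map_f. Qed.

Lemma arc_of_edge (R : eqType) (F : {set {set V}}) (T : seq (V * V * R))
    (e : {set V}) :
  orients F T -> e \in F -> exists2 x, x \in T & e = arc_ends x.
Proof. by move=> oT; rewrite -mem_enum -(perm_mem oT) => /mapP. Qed.

Lemma label_of_arc_mem (R : eqType) (F : {set {set V}}) (ls : seq R)
    (T : seq (V * V * R)) (x : V * V * R) :
  oriented_labelling F ls T -> x \in T -> label x \in ls.
Proof. by move=> /andP[_ T_ls] xT; rewrite -(perm_mem T_ls) map_f. Qed.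

Lemma oriented_labelling_cat (R : eqType) (F1 F2 : {set {set V}})
    (ls1 ls2 : seq R) (T1 T2 : seq (V * V * R)) :
  [disjoint F1 & F2] -> oriented_labelling F1 ls1 T1 ->
  oriented_labelling F2 ls2 T2 ->
  oriented_labelling (F1 :|: F2) (ls1 ++ ls2) (T1 ++ T2).
Proof.
move=> dF /andP[o1 p1] /andP[o2 p2]; rewrite /oriented_labelling /orients.
rewrite !map_cat (perm_cat p1 p2) andbT.
apply: (perm_trans (perm_cat o1 o2)); apply: uniq_perm.
- rewrite cat_uniq !enum_uniq andbT /=; apply/hasPn => e /=.
  by rewrite !mem_enum => eF2; rewrite (disjointFl dF eF2).
- exact: enum_uniq.
- by move=> e; rewrite mem_cat !mem_enum inE.
Qed.

Lemma oriented_labelling_catD (R : eqType) (F1 F : {set {set V}})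
    (ls1 ls2 : seq R) (T1 T2 : seq (V * V * R)) :
  F1 \subset F -> oriented_labelling F1 ls1 T1 ->
  oriented_labelling (F :\: F1) ls2 T2 ->
  oriented_labelling F (ls1 ++ ls2) (T1 ++ T2).
Proof.
move=> /setIidPr F1F o1 o2; rewrite -(setID F F1) F1F.
by apply: oriented_labelling_cat; rewrite // disjoints_subset setCD subsetUr.
Qed.

Lemma oriented_labelling_perm (R : eqType) (F : {set {set V}})
    (ls1 ls2 : seq R) (T : seq (V * V * R)) :
  perm_eq ls1 ls2 -> oriented_labelling F ls1 T -> oriented_labelling F ls2 T.
Proof.
by move=> ls12 /andP[oT T_ls]; rewrite /oriented_labelling oT (perm_trans T_ls).
Qed.

Lemma oriented_labelling_reverse (R : eqType) (F : {set {set V}})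
    (ls : seq R) (T : seq (V * V * R)) :
  oriented_labelling F ls (reverse_arcs T) = oriented_labelling F ls T.
Proof.
rewrite /oriented_labelling /orients -!map_comp; congr (perm_eq _ _ && _).
by apply: eq_map => x; apply: setUC.
Qed.

Lemma inflow_cat (R : nmodType) (T1 T2 : seq (V * V * R)) (v : V) :
  inflow (T1 ++ T2) v = inflow T1 v + inflow T2 v.
Proof. exact: big_cat. Qed.

Lemma outflow_cat (R : nmodType) (T1 T2 : seq (V * V * R)) (v : V) :
  outflow (T1 ++ T2) v = outflow T1 v + outflow T2 v.
Proof. exact: big_cat. Qed.

Lemma net_sum_cat (R : zmodType) (T1 T2 : seq (V * V * R)) (v : V) :
  net_sum (T1 ++ T2) v = net_sum T1 v + net_sum T2 v.
Proof. by rewrite /net_sum inflow_cat outflow_cat opprD addrACA. Qed.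

Lemma net_sum1 (R : zmodType) (x : V * V * R) (v : V) :
  net_sum [:: x] v = (if target x == v then label x else 0)
    - (if source x == v then label x else 0).
Proof.
rewrite /net_sum /inflow /outflow big_mkcond [X in _ - X]big_mkcond.
by rewrite !big_seq1.
Qed.

Lemma net_sum_reverse (R : zmodType) (T : seq (V * V * R)) (v : V) :
  net_sum (reverse_arcs T) v = - net_sum T v.
Proof. by rewrite /net_sum /inflow /outflow !big_map opprB. Qed.

Lemma net_sum_inflow (R : zmodType) (A B : {set V}) (T : seq (V * V * R))
    (v : V) :
  directed A B T -> v \notin A -> net_sum T v = inflow T v.
Proof.
move=> /allP T_dir vA; rewrite /net_sum [outflow T v]big1_seq ?subr0 // => x.
by move=> /andP[/eqP xv /T_dir/andP[]]; rewrite xv (negPf vA).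
Qed.

Lemma net_sum_outflow (R : zmodType) (A B : {set V}) (T : seq (V * V * R))
    (v : V) :
  directed A B T -> v \notin B -> net_sum T v = - outflow T v.
Proof.
move=> /allP T_dir vB; rewrite /net_sum [inflow T v]big1_seq ?sub0r // => x.
by move=> /andP[/eqP xv /T_dir/andP[_]]; rewrite xv (negPf vB).
Qed.

Lemma outflow_single_source (R : nmodType) (u : V) (B : {set V})
    (T : seq (V * V * R)) :
  directed [set u] B T -> outflow T u = \sum_(x <- T) label x.
Proof.
move=> /allP T_dir; rewrite /outflow big_seq_cond [RHS]big_seq.
by apply: eq_bigl => x; apply: andb_idr => /T_dir/andP[/set1P-> _].
Qed.

Lemma net_sum_isolated (R : zmodType) (F : {set {set V}})
    (T : seq (V * V * R)) (v : V) :
  orients F T -> (forall e, e \in F -> v \notin e) -> net_sum T v = 0.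
Proof.
move=> oT vF; have vT x : x \in T -> v \notin arc_ends x.
  by move/(arc_ends_mem oT)/vF.
rewrite /net_sum /inflow /outflow !big1_seq ?subrr // => x /andP[/eqP xv /vT].
  by rewrite -xv set21.
by rewrite -xv set22.
Qed.

Lemma label_le_inflow (R : realDomainType) (T : seq (V * V * R))
    (x : V * V * R) :
  (forall y, y \in T -> 0 <= label y) -> x \in T ->
  label x <= inflow T (target x).
Proof.
move=> T_ge0 xT; rewrite /inflow (big_rem x) //= eqxx lerDl.
by rewrite big_seq_cond sumr_ge0 // => y /andP[/mem_rem/T_ge0].
Qed.

Lemma outflow_ge0 (R : realDomainType) (T : seq (V * V * R)) (v : V) :
  (forall y, y \in T -> 0 <= label y) -> 0 <= outflow T v.
Proof.
by move=> T_ge0; rewrite /outflow big_seq_cond sumr_ge0 // => y /andP[/T_ge0].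
Qed.

Lemma inflow_le (R : realDomainType) (F : {set {set V}}) (A : {set V})
    (T : seq (V * V * R)) (m : R) (v : V) :
  orients F T -> 0 <= m -> (forall x, x \in T -> label x <= m) ->
  (forall x, x \in T -> target x = v -> source x \in A) ->
  inflow T v <= m *+ #|A|.
Proof.
move=> oT m_ge0 T_le TA; rewrite cardE.
apply: (@le_trans _ _ (m *+ count (fun x => target x == v) T)).
  rewrite -[_ *+ _]addr0 -iter_addr -big_const_seq /inflow.
  rewrite big_seq_cond [leRHS]big_seq_cond.
  by apply: ler_sum => x /andP[/T_le].
apply: ler_wpMn2l => //; rewrite -size_filter -(size_map (fun x => source x)).
apply: uniq_leq_size => [|u /mapP[x]]; last first.
  by rewrite mem_filter mem_enum => /andP[/eqP xv xT] ->; apply: TA.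
rewrite map_inj_in_uniq ?filter_uniq ?(map_uniq (orients_uniq oT)) // => x y.
rewrite !mem_filter => /andP[/eqP xv xT] /andP[/eqP yv yT] xy.
by apply: (uniq_map_inj (orients_uniq oT)); rewrite // /arc_ends xv yv xy.
Qed.

Lemma exists_arc_into (R : eqType) (F : {set {set V}}) (A B : {set V})
    (T : seq (V * V * R)) (e : {set V}) (v : V) :
  orients F T -> directed A B T -> [disjoint A & B] -> e \in F -> v \in e ->
  v \in B -> exists2 x, x \in T & target x = v.
Proof.
move=> oT /allP dT dAB /(arc_of_edge oT)[x xT ->] ve vB.
exists x => //; move: ve; rewrite !inE => /orP[]/eqP vE; rewrite vE //.
by have /andP[xA _] := dT x xT; rewrite vE (disjointFr dAB xA) in vB.
Qed.

Lemma exists_directed_labelling (R : eqType) (A B : {set V}) (F : {set {set V}})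
    (ls : seq R) :
  (forall e, e \in F -> exists u v, [/\ u \in A, v \in B & e = [set u; v]]) ->
  size ls = #|F| ->
  exists2 T, oriented_labelling F ls T & directed A B T.
Proof.
move=> FAB; rewrite cardE => sz.
have {}FAB e : e \in enum F ->
    exists u v, [/\ u \in A, v \in B & e = [set u; v]].
  by rewrite mem_enum; apply: FAB.
suff [T [TE lE TAB]] : exists T : seq (V * V * R),
    [/\ map (@arc_ends R) T = enum F, [seq label x | x <- T] = ls &
      directed A B T].
  by exists T; rewrite // /oriented_labelling /orients TE lE !perm_refl.
elim: (enum F) ls sz FAB => [|e s IH] [|l ls] //= => [_ _|[sz] FAB].
  by exists [::].
have [|T [TE lE TAB]] := IH ls sz.
  by move=> f fs; apply: FAB; rewrite inE fs orbT.
have [|u [v [uA vB eE]]] := FAB e; first exact: mem_head.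
by exists ((u, v, l) :: T); rewrite /= TE lE eE uA vB.
Qed.

End LabelledArcs.

(** * Balanced labellings *)

Section Balanced.
Variables (R : realDomainType) (V : finType).

Lemma ler_dist_range (a b x y : R) :
  a <= x <= b -> a <= y <= b -> `|x - y| <= b - a.
Proof.
by move=> /andP[ax xb] /andP[ay yb]; rewrite ler_norml opprB !lerB.
Qed.

(* In a decreasing [ls], [ls`_0] is the largest label, or 0 if there is none. *)
Definition balanceable (F : {set {set V}}) (ls : seq R) : Prop :=
  exists2 T : seq (V * V * R), oriented_labelling F ls T &
    forall v, `|net_sum T v| <= ls`_0.

(* The pendant edge is directed against the sum already present at [y]. *)
Lemma balanceable_pendant (F : {set {set V}}) (ls : seq R) (l : R) (x y : V) :
  x != y -> [set x; y] \in F ->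
  (forall e, e \in F -> x \in e -> e = [set x; y]) ->
  sorted >=%R (rcons ls l) -> 0 <= l ->
  balanceable (F :\ [set x; y]) ls -> balanceable F (rcons ls l).
Proof.
move=> xy xyF x_pendant srt l_ge0 [T oT T_le].
have yx : (y == x) = false by rewrite eq_sym (negPf xy).
have le_head m : m \in rcons ls l -> m <= (rcons ls l)`_0.
  exact: (sorted_nth0 0 ge_refl ge_trans srt).
have l_le : l <= (rcons ls l)`_0 by apply: le_head; rewrite mem_rcons mem_head.
have ls_le : ls`_0 <= (rcons ls l)`_0 by case: (ls) l_le => //= _; apply: lexx.
pose a : V * V := if 0 <= net_sum T y then (y, x) else (x, y).
have oa : oriented_labelling [set [set x; y]] [:: l] [:: (a, l)].
  rewrite /oriented_labelling /orients /= perm_refl andbT enum_set1 /a.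
  by case: ifP => _; rewrite /arc_ends //= setUC.
have Tx0 : net_sum T x = 0.
  apply: (net_sum_isolated (proj1 (andP oT))) => e.
  by rewrite !inE => /andP[ne eF]; apply: contra ne => /(x_pendant _ eF) ->.
exists ((a, l) :: T).
  apply: (@oriented_labelling_perm _ _ _ ([:: l] ++ ls)).
    by rewrite perm_sym perm_rcons.
  by apply: oriented_labelling_catD oa oT; rewrite sub1set.
move=> v; rewrite -cat1s net_sum_cat net_sum1 {oa}/a.
have T_leL w : `|net_sum T w| <= (rcons ls l)`_0 := le_trans (T_le w) ls_le.
have [->|nvx] := eqVneq v x.
  rewrite Tx0 addr0 -[leRHS]subr0.
  case: (0 <= _); rewrite /= eqxx yx; apply: ler_dist_range;
  by rewrite ?lexx ?l_ge0 ?(le_trans l_ge0).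
have [->|nvy] := eqVneq v y.
  rewrite -[leRHS]subr0; have := T_leL y; rewrite ler_norml => /andP[y_ge y_le].
  case: (lerP 0) => y_sign; rewrite /= eqxx (negPf xy).
    by rewrite sub0r addrC; apply: ler_dist_range; apply/andP.
  rewrite [l - 0]subr0 -[net_sum T y]opprK.
  apply: ler_dist_range; apply/andP=> //.
  by rewrite oppr_ge0 ltW // lerNl.
case: (0 <= _); rewrite /= ![_ == v]eq_sym (negPf nvx) (negPf nvy).
all: by rewrite subrr add0r.
Qed.

Definition cycle_arcs (c : seq V) (ls : seq R) : seq (V * V * R) :=
  zip [seq (x, next c x) | x <- c] ls.

Lemma oriented_labelling_cycle (c : seq V) (ls : seq R) :
  uniq c -> (2 < size c)%N -> size ls = size c ->
  oriented_labelling (cycle_edges c) ls (cycle_arcs c ls).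
Proof.
move=> uc sc sz; apply/andP; split; last first.
  by rewrite -/(unzip2 _) unzip2_zip ?size_map ?sz.
rewrite /orients -[map _ _]/(map ((fun a => [set a.1; a.2]) \o fst) _).
rewrite map_comp -/(unzip1 _) unzip1_zip ?size_map ?sz // -map_comp.
apply: uniq_perm; rewrite ?enum_uniq // ?map_inj_in_uniq //.
  exact: cycle_edge_inj.
by move=> e; rewrite mem_enum; apply/mapP/imsetP => -[x xc ->]; exists x.
Qed.

(* Around the cycle each vertex gains one label and loses another. *)
Lemma cycle_arcs_net_sum_le (c : seq V) (ls : seq R) (a b : R) (v : V) :
  uniq c -> size ls = size c -> a <= b -> (forall l, l \in ls -> a <= l <= b) ->
  `|net_sum (cycle_arcs c ls) v| <= b - a.
Proof.
move=> uc sz ab ls_ab.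
have fstE : map fst [seq (x, next c x) | x <- c] = c.
  by rewrite -map_comp map_id.
have sndE : map snd [seq (x, next c x) | x <- c] = map (next c) c.
  by rewrite -map_comp.
have u_next : uniq (map (next c) c).
  by rewrite map_inj_uniq //; apply: can_inj (prev_next uc).
have memE : (v \in map (next c) c) = (v \in c).
  apply/mapP/idP => [[x xc ->]|vc]; first by rewrite mem_next.
  by exists (prev c v); rewrite ?mem_prev ?next_prev.
have -> : net_sum (cycle_arcs c ls) v =
    ls`_(index v (map (next c) c)) - ls`_(index v c).
  by rewrite -[index v c](congr1 (index v) fstE) -sndE
    /net_sum /inflow /outflow !sum_zip_index ?fstE ?sndE ?size_map.
have [vc|vc] := boolP (v \in c); last first.
  rewrite !memNindex ?memE // size_map !nth_default ?sz //.
  by rewrite subrr normr0 subr_ge0.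
have nth_ab i : (i < size c)%N -> a <= ls`_i <= b.
  by rewrite -sz => /(mem_nth 0)/ls_ab.
have /nth_ab : (index v c < size c)%N by rewrite index_mem.
have /nth_ab : (index v (map (next c) c) < size c)%N.
  by rewrite -[leqRHS](size_map (next c)) index_mem memE.
by move=> in_range out_range; apply: ler_dist_range.
Qed.

Lemma balanceable_cycle (F : {set {set V}}) (c : seq V) (ls1 ls2 : seq R) :
  uniq c -> (2 < size c)%N -> cycle_edges c \subset F -> size ls1 = size c ->
  sorted >=%R (ls1 ++ ls2) -> (forall l, l \in ls1 -> 0 <= l) ->
  balanceable (F :\: cycle_edges c) ls2 -> balanceable F (ls1 ++ ls2).
Proof.
move=> uc sc cF sz srt ls1_ge0 [T oT T_le].
have ls1_range l : l \in ls1 -> ls2`_0 <= l <= (ls1 ++ ls2)`_0.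
  move=> ll; apply/andP; split.
    exact: (sorted_cat_nth0 ge_trans srt ll (ls1_ge0 l ll)).
  by apply: (sorted_nth0 0 ge_refl ge_trans srt); rewrite mem_cat ll.
have le_head : ls2`_0 <= (ls1 ++ ls2)`_0.
  have /ls1_range/andP[] : ls1`_0 \in ls1 by rewrite mem_nth // sz ltnW // ltnW.
  exact: le_trans.
exists (cycle_arcs c ls1 ++ T).
  apply: oriented_labelling_catD cF _ oT.
  exact: oriented_labelling_cycle.
move=> v; rewrite net_sum_cat; apply: (le_trans (ler_normD _ _)).
rewrite -[leRHS](subrK ls2`_0); apply: lerD (T_le v).
exact: cycle_arcs_net_sum_le.
Qed.

Theorem balanceable_sorted (F : {set {set V}}) (ls : seq R) :
  (forall e, e \in F -> #|e| = 2%N) -> size ls = #|F| -> sorted >=%R ls ->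
  (forall l, l \in ls -> 0 <= l) -> balanceable F ls.
Proof.
have [n] := ubnP #|F|; elim: n => // n IH in F ls *.
rewrite ltnS => le_n F2 sz srt ls_ge0.
have [F0|F_n0] := eqVneq F set0.
  move: sz; rewrite F0 cards0 => /size0nil->; exists [::] => [|v].
    by rewrite /oriented_labelling /orients enum_set0.
  by rewrite /net_sum /inflow /outflow !big_nil subrr normr0.
have [[x [y [xy xyF x_pendant]]]|[c [uc sc cF]]] :=
  pendant_edge_or_cycle F2 F_n0.
  have szF : size ls = #|F :\ [set x; y]|.+1.
    by rewrite sz (cardsD1 [set x; y]) xyF.
  case/lastP: ls => [//|ls l] in sz srt ls_ge0 szF *.
  have l_ge0 : 0 <= l by apply: ls_ge0; rewrite mem_rcons mem_head.
  apply: (balanceable_pendant xy) => //; apply: IH.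
  - by rewrite -szF sz.
  - by move=> e; rewrite !inE => /andP[_ /F2].
  - by case: szF; rewrite size_rcons => -[].
  - by move: srt; rewrite -cats1 => /cat_sorted2[].
  by move=> m mls; apply: ls_ge0; rewrite mem_rcons inE mls orbT.
have szF : #|F| = (size c + #|F :\: cycle_edges c|)%N.
  rewrite -(card_cycle_edges uc sc) -(cardsID (cycle_edges c) F).
  by rewrite (setIidPr cF).
have [ls1 [ls2 [lsE sz1 sz2]]] := split_size (etrans sz szF).
rewrite lsE in srt ls_ge0 *; apply: (balanceable_cycle uc sc cF sz1 srt).
  by move=> l ll; apply: ls_ge0; rewrite mem_cat ll.
apply: IH => //.
- apply: leq_trans le_n; rewrite szF -[ltnLHS]add0n ltn_add2r.
  exact: ltn_trans sc.
- by move=> f; rewrite inE => /andP[_ /F2].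
- by case/cat_sorted2: srt.
by move=> l ll; apply: ls_ge0; rewrite mem_cat ll orbT.
Qed.

End Balanced.

(** * Bipartite labellings *)

Section Parents.
Variables (V : finType) (f : V -> V).

Definition parent_edges (B : {set V}) : {set {set V}} :=
  [set [set f v; v] | v in B].

Definition parent_arcs (R : Type) (h : V -> R) (B : {set V}) :
  seq (V * V * R) :=
  [seq (f v, v, h v) | v <- enum B].

Lemma parent_edge_inj (A B : {set V}) :
  [disjoint A & B] -> (forall v, v \in B -> f v \in A) ->
  {in B &, injective (fun v => [set f v; v])}.
Proof.
move=> dAB fA v w vB wB /set2_inj[[]//|[_ vE]].
by have := fA w wB; rewrite -vE (disjointFl dAB vB).
Qed.

Lemma oriented_labelling_parent (R : eqType) (h : V -> R) (B : {set V})
    (ls : seq R) :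
  {in B &, injective (fun v => [set f v; v])} -> perm_eq (map h (enum B)) ls ->
  oriented_labelling (parent_edges B) ls (parent_arcs h B).
Proof.
move=> f_inj h_lab; rewrite /oriented_labelling /orients -!map_comp h_lab andbT.
apply: uniq_perm; rewrite ?map_inj_in_uniq ?enum_uniq //.
  by move=> v w; rewrite !mem_enum; apply: f_inj.
move=> e; rewrite mem_enum; apply/mapP/imsetP => -[v vB ->]; exists v => //.
  by rewrite mem_enum in vB.
by rewrite mem_enum.
Qed.

Lemma inflow_parent (R : nmodType) (h : V -> R) (B : {set V}) (v : V) :
  v \in B -> inflow (parent_arcs h B) v = h v.
Proof.
move=> vB; rewrite /inflow big_map big_enum_cond /= (big_pred1 v) // => w /=.
by rewrite andbC; case: eqP => /= [->|].
Qed.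

End Parents.

(* One edge at each vertex of [B] is set aside; these edges take the first
   labels, in the order of the sums over all the other edges. *)
Lemma bipartite_relabelling (R : realDomainType) (V : finType) (A B : {set V})
    (F : {set {set V}}) (ls : seq R) (p : V -> R) :
  [disjoint A & B] ->
  (forall e, e \in F -> exists u v, [/\ u \in A, v \in B & e = [set u; v]]) ->
  (forall v, v \in B -> exists2 u, u \in A & [set u; v] \in F) ->
  size ls = #|F| -> uniq ls ->
  exists T : seq (V * V * R), [/\ oriented_labelling F ls T, directed A B T &
    {in B &, injective (fun v => p v + inflow T v)}].
Proof.
move=> dAB FAB BF sz uls.
have [f fP] : exists f : V -> V, forall v, v \in B ->
    f v \in A /\ [set f v; v] \in F.
  apply: (@fin_all_exists _ _
    (fun v u => v \in B -> u \in A /\ [set u; v] \in F)).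
  move=> v; have [/BF[u uA uF]|vB] := boolP (v \in B); first by exists u.
  by exists v.
pose F1 := parent_edges f B.
have fA v : v \in B -> f v \in A by case/fP.
have F1_inj := parent_edge_inj dAB fA.
have F1F : F1 \subset F by apply/subsetP => e /imsetP[v /fP[_ ?] ->].
have szF : size ls = (#|B| + #|F :\: F1|)%N.
  by rewrite sz -(card_in_imset F1_inj) -(cardsID F1 F) (setIidPr F1F).
have [ls1 [ls2 [lsE sz1 sz2]]] := split_size szF.
have [|T2 T2_lab T2_dir] :=
  @exists_directed_labelling _ _ A B (F :\: F1) ls2 _ sz2.
  by move=> e; rewrite inE => /andP[_ /FAB].
have uls1 : uniq ls1 by move: uls; rewrite lsE cat_uniq => /and3P[].
have [h h_lab h_inj] := injective_relabelling (fun v => p v + inflow T2 v)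
  (enum_uniq B) uls1 (etrans sz1 (cardE B)).
pose T1 := parent_arcs f h B.
exists (T1 ++ T2); split.
- rewrite lsE; apply: oriented_labelling_catD F1F _ T2_lab.
  exact: oriented_labelling_parent.
- rewrite /directed all_cat -/(directed A B T2) T2_dir andbT.
  by apply/allP => x /mapP[v]; rewrite mem_enum => vB -> /=; rewrite fA.
move=> v w vB wB /=; rewrite !inflow_cat !inflow_parent //.
by rewrite ![h _ + _]addrC !addrA; apply: h_inj; rewrite mem_enum.
Qed.

(** * Edges of a graph *)

Section Edges.
Variable G : sgraph.

Definition edges_between (A B : {set G}) : {set {set G}} :=
  [set [set p.1; p.2] | p : G * G & [&& p.1 \in A, p.2 \in B & adj p.1 p.2]].

Lemma edges_betweenP (A B : {set G}) (e : {set G}) :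
  reflect (exists u v, [/\ u \in A, v \in B, adj u v & e = [set u; v]])
    (e \in edges_between A B).
Proof.
apply: (iffP imsetP) => [[[u v]]|[u [v [uA vB uv ->]]]].
  by rewrite inE => /and3P[uA vB uv] ->; exists u, v.
by exists (u, v); rewrite ?inE //= uA vB.
Qed.

Lemma mem_edges_between (A B : {set G}) (x y : G) :
  ([set x; y] \in edges_between A B) =
  adj x y && ((x \in A) && (y \in B) || (y \in A) && (x \in B)).
Proof.
apply/edges_betweenP/andP => [[u [v [uA vB uv]]]|[xy]].
  move=> /set2_inj[][-> ->]; first by rewrite uA vB.
  by rewrite adj_sym uA vB orbT.
case/orP => /andP[xA yB]; first by exists x, y.
by exists y, x; rewrite adj_sym setUC.
Qed.

Lemma edge_set_between : edge_set G = edges_between setT setT.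
Proof.
apply/setP => e; apply/imsetP/imsetP => -[p pE ->]; exists p => //.
all: by rewrite !inE in pE *.
Qed.

Lemma mem_edge_set (x y : G) : ([set x; y] \in edge_set G) = adj x y.
Proof. by rewrite edge_set_between mem_edges_between !in_setT !andbT. Qed.

Lemma edge_setP (e : {set G}) :
  reflect (exists u v, adj u v /\ e = [set u; v]) (e \in edge_set G).
Proof.
rewrite edge_set_between; apply: (iffP (edges_betweenP _ _ _)).
  by case=> u [v [_ _ uv ->]]; exists u, v.
by case=> u [v [uv ->]]; exists u, v; rewrite !inE.
Qed.

Lemma edges_between_sub (A B : {set G}) : edges_between A B \subset edge_set G.
Proof.
by apply/subsetP => e /edges_betweenP[u [v [_ _ uv ->]]]; rewrite mem_edge_set.
Qed.

Lemma edges_between_notin (A B : {set G}) (v : G) (e : {set G}) :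
  v \notin A -> v \notin B -> e \in edges_between A B -> v \notin e.
Proof.
move=> vA vB /edges_betweenP[a [b [aA bB _ ->]]]; rewrite in_set2 negb_or.
by rewrite (memPnC vA) ?(memPnC vB).
Qed.

Lemma card_edge (e : {set G}) : e \in edge_set G -> #|e| = 2%N.
Proof.
case/edge_setP=> u [v [uv ->]]; rewrite cards2.
by case: eqVneq uv => // ->; rewrite adj_irrefl.
Qed.

End Edges.

Lemma exists_arc_of_edge (R : eqType) (G : sgraph) (T : seq (G * G * R)) :
  orients (edge_set G) T ->
  exists2 arc : edge G -> G * G * R,
    forall a, val a = arc_ends (arc a) & perm_eq (map arc (enum (edge G))) T.
Proof.
move=> oT.
have [a|arc arcT arcE] := @fin_all_exists2 _ _ (fun _ x => x \in T)
    (fun a : edge G => fun x => val a = arc_ends x).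
  exact: arc_of_edge oT (valP a).
exists arc => //; apply: uniq_perm.
- rewrite map_inj_uniq ?enum_uniq // => a b ab.
  by apply: val_inj; rewrite !arcE ab.
- exact: map_uniq (orients_uniq oT).
move=> x; apply/mapP/idP => [[a _ ->] //|xT].
exists (Sub (arc_ends x) (arc_ends_mem oT xT) : edge G).
  by rewrite mem_enum.
by apply: (uniq_map_inj (orients_uniq oT)); rewrite // -arcE.
Qed.

Lemma antimagic_of_oriented_labelling (R : realType) (G : sgraph) (L : {fset R})
    (T : seq (G * G * R)) :
  oriented_labelling (edge_set G) L T -> injective (net_sum T) ->
  exists (D : orientation G) (tau : edge G -> L),
    bijective tau /\ injective (vertex_sum D (fun a => val (tau a))).
Proof.
move=> /andP[oT TL] T_inj; have [arc arcE arcT] := exists_arc_of_edge oT.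
have labT : perm_eq [seq label (arc a) | a <- enum (edge G)] L.
  apply: perm_trans TL; rewrite (map_comp (fun x => label x) arc).
  exact: perm_map.
have labL a : label (arc a) \in L.
  by rewrite -(perm_mem labT); apply/mapP; exists a; rewrite ?mem_enum.
pose D : orientation G :=
  @Orientation G (fun a => source (arc a)) (fun a => target (arc a)) arcE.
pose tau (a : edge G) : L := [` labL a]%fset.
have sumE (P : pred (G * G * R)) :
    \sum_(a : edge G | P (arc a)) label (arc a) = \sum_(x <- T | P x) label x.
  by rewrite -(perm_big _ arcT) big_map big_enum_cond.
exists D, tau; split.
  apply: inj_card_bij => [a b /(congr1 val) /= ab|].
    have /uniq_map_inj : uniq [seq label (arc a) | a <- enum (edge G)].
      by rewrite (perm_uniq labT) fset_uniq.
    by apply; rewrite ?mem_enum.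
  by rewrite -cardfE -(perm_size labT) size_map -cardE.
suff vertex_sumE : vertex_sum D (fun a => val (tau a)) =1 net_sum T.
  by move=> u v; rewrite !vertex_sumE; apply: T_inj.
by move=> v; rewrite /vertex_sum (sumE (fun x => target x == v))
  (sumE (fun x => source x == v)).
Qed.

(** * Distance layers *)

Definition neighbors (G : sgraph) (x : G) : {set G} := [set y | adj x y].

Definition far (G : sgraph) (x : G) : {set G} :=
  [set y | (y != x) && ~~ adj x y].

Definition within_two (G : sgraph) (x : G) : bool :=
  [forall y in far x, [exists u in neighbors x, adj u y]].

Lemma exists_eccentricity_le_radius (G : sgraph) :
  (0 < radius G)%N -> exists x : G, (eccentricity x <= radius G)%N.
Proof.
apply: (big_ind (fun t => 0 < t -> exists x : G, eccentricity x <= t)%N).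
- move=> /card_gt0P[x _]; exists x; apply/bigmax_leqP => y _.
  by rewrite -[leqRHS](size_iota 0) find_size.
- by move=> m n IHm IHn; case: (leqP m n).
by move=> x _ _; exists x.
Qed.

Lemma walk_dist (G : sgraph) (x y : G) :
  connected G -> walk_of_length x y (dist x y).
Proof.
move=> G_conn.
have walk : has (walk_of_length x y) (iota 0 #|G|).
  have /connectP[p0 pp0 yE] := G_conn x y.
  case/shortenP: pp0 yE => p pp up _ yE; apply/hasP; exists (size p).
    rewrite mem_iota /= add0n.
    by rewrite -[leqLHS]/(size (x :: p)) -(card_uniqP up) max_card.
  by apply/existsP; exists (in_tuple p); rewrite /= pp yE eqxx.
have := nth_find 0%N walk; rewrite nth_iota //.
by rewrite -[ltnRHS](size_iota 0) -has_find.
Qed.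

Lemma within_two_of_eccentricity (G : sgraph) (x : G) :
  connected G -> (eccentricity x <= 2)%N -> within_two x.
Proof.
move=> G_conn x_ecc; apply/forallP => y; apply/implyP.
rewrite inE => /andP[yx nxy].
have : (dist x y <= 2)%N by apply: leq_trans x_ecc; apply: leq_bigmax.
have := walk_dist x y G_conn.
case: (dist x y) => [|[|[|//]]] /existsP[] [] [|a [|b [|//]]] //= _.
- by rewrite eq_sym (negPf yx).
- by rewrite andbT => /andP[xa /eqP ay]; rewrite -ay xa in nxy.
rewrite andbT => /andP[/andP[xa ab] /eqP<-] _.
by apply/existsP; exists a; rewrite inE xa.
Qed.

Section Layers.
Variables (G : sgraph) (r : G).

Definition star_edges : {set {set G}} := edges_between [set r] (neighbors r).

Definition cross_edges : {set {set G}} := edges_between (neighbors r) (far r).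

Definition inner_edges : {set {set G}} :=
  edges_between (neighbors r) (neighbors r) :|: edges_between (far r) (far r).

Lemma layer_cases (v : G) : [\/ v = r, v \in neighbors r | v \in far r].
Proof.
have [->|vr] := eqVneq v r; first exact: Or31.
have [rv|rv] := boolP (adj r v); [apply: Or32 | apply: Or33];
  by rewrite inE ?vr.
Qed.

Lemma center_notin_neighbors : r \notin neighbors r.
Proof. by rewrite inE adj_irrefl. Qed.

Lemma center_notin_far : r \notin far r.
Proof. by rewrite inE eqxx. Qed.

Lemma neighbors_notin_far (u : G) : u \in neighbors r -> u \notin far r.
Proof. by rewrite !inE => ->; rewrite andbF. Qed.

Lemma far_notin_neighbors (v : G) : v \in far r -> v \notin neighbors r.
Proof. exact/contraL/neighbors_notin_far. Qed.

Lemma disjoint_center_neighbors : [disjoint [set r] & neighbors r].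
Proof. by rewrite disjoints1 center_notin_neighbors. Qed.

Lemma disjoint_neighbors_far : [disjoint neighbors r & far r].
Proof.
rewrite disjoints_subset; apply/subsetP => u.
by rewrite in_setC => /neighbors_notin_far.
Qed.

Lemma mem_star_edges (u : G) : u \in neighbors r -> [set r; u] \in star_edges.
Proof. by rewrite mem_edges_between !inE eqxx => ->. Qed.

Lemma edge_set_layers :
  edge_set G = star_edges :|: (cross_edges :|: inner_edges).
Proof.
apply/eqP; rewrite eqEsubset !subUset !edges_between_sub !andbT.
apply/subsetP => _ /edge_setP[u [v [uv ->]]].
rewrite !in_setU !mem_edges_between uv /= !inE.
case: (eqVneq u r) uv => [->|_]; case: (eqVneq v r) => [->|_] /=.
- by rewrite adj_irrefl.
- by move=> ->.
- by rewrite adj_sym => ->.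
by move=> _; case: (adj r u); case: (adj r v).
Qed.

Lemma disjoint_star_edges :
  [disjoint star_edges & cross_edges :|: inner_edges].
Proof.
rewrite disjoints_subset; apply/subsetP => e.
move=> /edges_betweenP[_ [v [/set1P-> _ _ ->]]].
rewrite !(in_setU, in_setC) !mem_edges_between.
by rewrite (negPf center_notin_neighbors) (negPf center_notin_far) !andbF.
Qed.

Lemma disjoint_cross_edges : [disjoint cross_edges & inner_edges].
Proof.
rewrite disjoints_subset; apply/subsetP => e.
move=> /edges_betweenP[u [v [uN vF _ ->]]].
rewrite !(in_setU, in_setC) !mem_edges_between.
rewrite (negPf (neighbors_notin_far uN)) (negPf (far_notin_neighbors vF)).
by rewrite !andbF.
Qed.

Lemma card_edge_set_layers :
  #|edge_set G| = (#|star_edges| + (#|cross_edges| + #|inner_edges|))%N.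
Proof.
rewrite edge_set_layers (eqTleqif (leq_card_setU _ _) disjoint_star_edges).
by rewrite (eqTleqif (leq_card_setU _ _) disjoint_cross_edges).
Qed.

End Layers.

Lemma exists_cross_edge (G : sgraph) (r v : G) :
  within_two r -> v \in far r ->
  exists2 u, u \in neighbors r & [set u; v] \in cross_edges r.
Proof.
move=> /forall_inP/(_ v) r_two vF; have /exists_inP[u uN uv] := r_two vF.
by exists u; rewrite // mem_edges_between uv uN vF.
Qed.

Lemma within_two_neighbors_sub (G : sgraph) (r v : G) :
  within_two r -> v \in far r -> neighbors r \subset neighbors v ->
  within_two v.
Proof.
move=> r_two vF /subsetP N_sub; apply/forall_inP => y yv; apply/exists_inP.
have nvy : ~~ adj v y by move: yv; rewrite inE => /andP[].
have [yr|yN|yF] := layer_cases r y.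
- have [u uN _] := exists_cross_edge r_two vF.
  by exists u; rewrite ?N_sub // yr adj_sym -in_set.
- by have := N_sub y yN; rewrite inE (negPf nvy).
have /exists_inP[u uN uy] := forall_inP r_two y yF.
by exists u; rewrite ?N_sub.
Qed.

(* All the neighbours of such a vertex are neighbours of [r], so it has none in
   its own layer. *)
Lemma inner_edges_notin (G : sgraph) (r v : G) (e : {set G}) :
  v \in far r -> neighbors v = neighbors r -> e \in inner_edges r -> v \notin e.
Proof.
move=> vF vN; have v_not_near := far_notin_neighbors vF.
rewrite in_setU => /orP[/(edges_between_notin v_not_near v_not_near)//|].
case/edges_betweenP=> a [b [aF bF ab ->]]; rewrite in_set2 negb_or.
have far_nadj w : w \in far r -> ~~ adj v w.
  by move/far_notin_neighbors; rewrite -vN inE.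
apply/andP; split.
  by apply: contraTneq (far_nadj b bF) => ->; rewrite negbK.
by apply: contraTneq (far_nadj a aF) => ->; rewrite negbK adj_sym.
Qed.

Section LayeredLabelling.
Variables (R : realDomainType) (G : sgraph) (r : G).
Variables (star cross inner : seq (G * G * R)) (M m : R).

Hypothesis r_two : within_two r.
Hypothesis r_max :
  forall x : G, within_two x -> (#|neighbors x| <= #|neighbors r|)%N.

Hypothesis star_orients : orients (star_edges r) star.
Hypothesis star_directed : directed [set r] (neighbors r) star.
Hypothesis cross_orients : orients (cross_edges r) cross.
Hypothesis cross_directed : directed (neighbors r) (far r) cross.
Hypothesis inner_orients : orients (inner_edges r) inner.

Hypothesis inner_le : forall v, `|net_sum inner v| <= M.
Hypothesis cross_gt : forall x, x \in cross -> M < label x.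
Hypothesis cross_le : forall x, x \in cross -> label x <= m.
Hypothesis star_gt : forall x, x \in star -> m < label x.
Hypothesis M_le : M <= m.

Hypothesis star_inj :
  {in neighbors r &,
    injective (fun u => - net_sum (cross ++ inner) u + inflow star u)}.
Hypothesis cross_inj :
  {in far r &, injective (fun v => net_sum inner v + inflow cross v)}.

Definition layered_arcs : seq (G * G * R) :=
  reverse_arcs star ++ cross ++ inner.

Local Notation s := (net_sum layered_arcs).

Let M_ge0 : 0 <= M.
Proof. exact: le_trans (normr_ge0 _) (inner_le r). Qed.

Let cross_ge0 x : x \in cross -> 0 <= label x.
Proof. by move=> /cross_gt/ltW; apply: le_trans. Qed.

Let star_ge0 x : x \in star -> 0 <= label x.
Proof. by move=> /star_gt/ltW; apply: le_trans; apply: le_trans M_le. Qed.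

Lemma net_sum_center : s r = \sum_(x <- star) label x.
Proof.
have rN := center_notin_neighbors r; have rF := center_notin_far r.
rewrite !net_sum_cat net_sum_reverse (net_sum_outflow star_directed) // opprK.
rewrite (outflow_single_source star_directed).
rewrite (net_sum_isolated cross_orients); last first.
  by move=> e; apply: edges_between_notin.
rewrite (net_sum_isolated inner_orients) ?addr0 // => e; rewrite in_setU.
by case/orP; apply: edges_between_notin.
Qed.

Lemma net_sum_near u :
  u \in neighbors r -> s u = - (- net_sum (cross ++ inner) u + inflow star u).
Proof.
move=> uN; rewrite (net_sum_cat (reverse_arcs star)) net_sum_reverse.
rewrite (net_sum_inflow star_directed) ?opprD ?opprK 1?addrC //.
by rewrite (disjointFl (disjoint_center_neighbors r)).
Qed.

Lemma net_sum_far v : v \in far r -> s v = net_sum inner v + inflow cross v.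
Proof.
move=> vF; have vN := far_notin_neighbors vF.
rewrite !net_sum_cat net_sum_reverse (net_sum_isolated star_orients).
  by rewrite oppr0 add0r (net_sum_inflow cross_directed) // addrC.
move=> e; apply: edges_between_notin => //.
by rewrite inE; apply: contraTneq vF => ->; rewrite center_notin_far.
Qed.

Lemma exists_star_arc_into u :
  u \in neighbors r -> exists2 x, x \in star & target x = u.
Proof.
move=> uN; exact: (exists_arc_into star_orients star_directed
  (disjoint_center_neighbors r) (mem_star_edges uN) (set22 r u) uN).
Qed.

Lemma net_sum_near_lt0 u : u \in neighbors r -> s u < 0.
Proof.
move=> uN; have [x x_star xu] := exists_star_arc_into uN.
have star_label := label_le_inflow star_ge0 x_star.
rewrite xu in star_label.
rewrite net_sum_near // oppr_lt0 net_sum_cat.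
rewrite (net_sum_outflow cross_directed) ?neighbors_notin_far //.
rewrite opprD opprK -addrA ltr_wpDl ?outflow_ge0 // addrC subr_gt0.
apply: le_lt_trans (lt_le_trans (star_gt x_star) star_label).
exact: le_trans (ler_norm _) (le_trans (inner_le u) M_le).
Qed.

Lemma net_sum_far_gt0 v : v \in far r -> 0 < s v.
Proof.
move=> vF; have [u _ uv_cross] := exists_cross_edge r_two vF.
have [x x_cross xv] := exists_arc_into cross_orients cross_directed
  (disjoint_neighbors_far r) uv_cross (set22 u v) vF.
have cross_label := label_le_inflow cross_ge0 x_cross.
rewrite xv in cross_label.
rewrite net_sum_far // -ltrBlDl sub0r.
apply: le_lt_trans (lt_le_trans (cross_gt x_cross) cross_label).
by apply: le_trans (inner_le v); rewrite -normrN ler_norm.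
Qed.

Lemma neighbors_mulrn_lt_center v : v \in far r -> m *+ #|neighbors r| < s r.
Proof.
move=> vF; rewrite net_sum_center.
have [u uN _] := exists_cross_edge r_two vF.
have [x x_star _] := exists_star_arc_into uN.
have N_le : (#|neighbors r| <= size star)%N.
  rewrite cardE -(size_map (fun x => target x)).
  apply: uniq_leq_size (enum_uniq _) _.
  move=> w; rewrite mem_enum => /exists_star_arc_into[y y_star <-].
  by apply/mapP; exists y.
apply: (@le_lt_trans _ _ (m *+ size star)).
  by apply: ler_wpMn2l N_le; apply: le_trans M_le.
rewrite -[_ *+ _]addr0 -iter_addr -(count_predT star) -big_const_seq.
rewrite big_seq [ltRHS]big_seq; apply: ltr_sum => //.
by apply/hasP; exists x.
Qed.

(* Either [v] misses a neighbour of [r], and [M] does not make up for the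
   missing edge, or [v] has the neighbours of [r] by maximality of the degree
   of [r], and then [v] lies on no inner edge. *)
Lemma net_sum_far_lt_center v : v \in far r -> s v < s r.
Proof.
move=> vF; apply: le_lt_trans (neighbors_mulrn_lt_center vF).
rewrite net_sum_far //.
have m_ge0 := le_trans M_ge0 M_le.
have cross_inflow : inflow cross v <= m *+ #|neighbors v :&: neighbors r|.
  apply: (inflow_le cross_orients) => // x x_cross xv.
  have /andP[xN _] := allP cross_directed x x_cross.
  have := arc_ends_mem cross_orients x_cross.
  rewrite mem_edges_between xv => /andP[xv_adj _].
  by rewrite in_setI xN inE adj_sym xv_adj.
have [N_sub|N_nsub] := boolP (neighbors r \subset neighbors v).
  have vN : neighbors v = neighbors r.
    apply/esym/eqP; rewrite eqEcard N_sub r_max //.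
    exact: within_two_neighbors_sub N_sub.
  rewrite (net_sum_isolated inner_orients) ?add0r; last first.
    by move=> e; apply: inner_edges_notin.
  by rewrite vN setIid in cross_inflow.
have N_lt : (#|neighbors v :&: neighbors r| < #|neighbors r|)%N.
  by apply: proper_card; rewrite properE subsetIr subsetI negb_and N_nsub.
apply: (le_trans _ (ler_wpMn2l m_ge0 N_lt)); rewrite mulrS; apply: lerD => //.
exact: le_trans (ler_norm _) (le_trans (inner_le v) M_le).
Qed.

Lemma net_sum_center_ge0 : 0 <= s r.
Proof.
by rewrite net_sum_center big_seq sumr_ge0.
Qed.

Lemma mem_neighbors_net_sum v : (v \in neighbors r) = (s v < 0).
Proof.
have [->|vN|vF] := layer_cases r v.
- by rewrite ltNge net_sum_center_ge0 (negPf (center_notin_neighbors r)).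
- by rewrite vN net_sum_near_lt0.
by rewrite (negPf (far_notin_neighbors vF)) lt_gtF ?net_sum_far_gt0.
Qed.

Lemma mem_far_net_sum v : (v \in far r) = (0 < s v < s r).
Proof.
have [->|vN|vF] := layer_cases r v.
- by rewrite ltxx andbF (negPf (center_notin_far r)).
- by rewrite (negPf (neighbors_notin_far vN)) lt_gtF ?net_sum_near_lt0.
by rewrite vF net_sum_far_gt0 ?net_sum_far_lt_center.
Qed.

Lemma net_sum_layered_inj : injective s.
Proof.
move=> x y s_xy.
have N_xy : (x \in neighbors r) = (y \in neighbors r).
  by rewrite !mem_neighbors_net_sum s_xy.
have F_xy : (x \in far r) = (y \in far r) by rewrite !mem_far_net_sum s_xy.
move: N_xy F_xy; have [->|xN|xF] := layer_cases r x => N_xy F_xy.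
- have [->//|yN|yF] := layer_cases r y.
    by rewrite yN (negPf (center_notin_neighbors r)) in N_xy.
  by rewrite yF (negPf (center_notin_far r)) in F_xy.
- have yN : y \in neighbors r by rewrite -N_xy.
  by apply: star_inj => //; apply: oppr_inj; rewrite -!net_sum_near.
have yF : y \in far r by rewrite -F_xy.
by apply: cross_inj => //; rewrite -!net_sum_far.
Qed.

End LayeredLabelling.

Section Existence.
Variables (R : realDomainType) (G : sgraph) (r : G).

Lemma exists_star_labelling (ls : seq R) (p : G -> R) :
  size ls = #|star_edges r| -> uniq ls ->
  exists T, [/\ oriented_labelling (star_edges r) ls T,
    directed [set r] (neighbors r) T &
    {in neighbors r &, injective (fun u => p u + inflow T u)}].
Proof.
apply: bipartite_relabelling; first exact: disjoint_center_neighbors.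
  by move=> e /edges_betweenP[u [v [ur vN _ ->]]]; exists u, v.
by move=> v vN; exists r; rewrite ?set11 ?mem_star_edges.
Qed.

Lemma exists_cross_labelling (ls : seq R) (p : G -> R) :
  within_two r -> size ls = #|cross_edges r| -> uniq ls ->
  exists T, [/\ oriented_labelling (cross_edges r) ls T,
    directed (neighbors r) (far r) T &
    {in far r &, injective (fun v => p v + inflow T v)}].
Proof.
move=> r_two; apply: bipartite_relabelling; first exact: disjoint_neighbors_far.
  by move=> e /edges_betweenP[u [v [uN vF _ ->]]]; exists u, v.
by move=> v; apply: exists_cross_edge.
Qed.

Lemma balanceable_inner_edges (ls : seq R) :
  size ls = #|inner_edges r| -> sorted >=%R ls ->
  (forall l, l \in ls -> 0 <= l) ->
  balanceable (inner_edges r) ls.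
Proof.
apply: balanceable_sorted => e e_inner; apply: card_edge.
by rewrite (edge_set_layers r) 2!in_setU e_inner !orbT.
Qed.

Lemma exists_injective_labelling (ls : seq R) :
  within_two r ->
  (forall x : G, within_two x -> (#|neighbors x| <= #|neighbors r|)%N) ->
  size ls = #|edge_set G| -> sorted >%R ls -> (forall l, l \in ls -> 0 < l) ->
  exists2 T : seq (G * G * R), oriented_labelling (edge_set G) ls T &
    injective (net_sum T).
Proof.
move=> r_two r_max; rewrite (card_edge_set_layers r).
case/split_size=> [l1 [l23 [-> sz1 /split_size[l2 [l3 [-> sz2 sz3]]]]]].
move=> srt ls_gt0.
have gt_trans : transitive (>%R : rel R) := rev_trans lt_trans.
have gt_ge (l : seq R) : sorted >%R l -> sorted >=%R l.
  by apply: sub_sorted => x y; apply: ltW.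
have /cat_sorted2[_ srt23] := srt; have /cat_sorted2[_ srt3] := srt23.
have := sorted_uniq gt_trans (@ltxx _ _) srt.
rewrite !cat_uniq => /and3P[uniq1 _ /and3P[uniq2 _ _]].
have l1_gt l : l \in l1 -> (l2 ++ l3)`_0 < l.
  move=> ll; apply: (sorted_cat_nth0 gt_trans srt ll).
  by apply: ls_gt0; rewrite mem_cat ll.
have l2_gt l : l \in l2 -> l3`_0 < l.
  move=> ll; apply: (sorted_cat_nth0 gt_trans srt23 ll).
  by apply: ls_gt0; rewrite !mem_cat ll orbT.
have l2_le l : l \in l2 -> l <= (l2 ++ l3)`_0.
  move=> ll; apply: (sorted_nth0 0 ge_refl ge_trans (gt_ge _ srt23)).
  by rewrite mem_cat ll.
have M_le : l3`_0 <= (l2 ++ l3)`_0.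
  by case: (l2) l2_gt => //= l l2' l2_gt; apply/ltW/l2_gt/mem_head.
have [|inner inner_lab inner_le] := balanceable_inner_edges sz3 (gt_ge _ srt3).
  by move=> l ll; rewrite ltW // ls_gt0 // !mem_cat ll !orbT.
have [cross [cross_lab cross_dir cross_inj]] :=
  exists_cross_labelling (net_sum inner) r_two sz2 uniq2.
have [star [star_lab star_dir star_inj]] :=
  exists_star_labelling (fun u => - net_sum (cross ++ inner) u) sz1 uniq1.
exists (layered_arcs star cross inner).
  rewrite (edge_set_layers r).
  apply: oriented_labelling_cat (disjoint_star_edges r) _ _.
    by rewrite oriented_labelling_reverse.
  exact: oriented_labelling_cat (disjoint_cross_edges r) cross_lab inner_lab.
have [[star_or _] [cross_or _] [inner_or _]] :=
  And3 (andP star_lab) (andP cross_lab) (andP inner_lab).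
pose M := l3`_0; pose m := (l2 ++ l3)`_0.
apply: (net_sum_layered_inj (M := M) (m := m) r_two r_max) => // x.
- by move=> /(label_of_arc_mem cross_lab)/l2_gt.
- by move=> /(label_of_arc_mem cross_lab)/l2_le.
by move=> /(label_of_arc_mem star_lab)/l1_gt.
Qed.

End Existence.

Theorem theorem3 (R : realType) (G : sgraph)
    (G_connected : connected G) (G_radius : radius G = 2%N) :
  universal_antimagic_orientable R G.
Proof.
move=> L L_size L_gt0.
have [|x0] := @exists_eccentricity_le_radius G; first by rewrite G_radius.
rewrite G_radius => /(within_two_of_eccentricity G_connected) x0_two.
have [r r_two r_max] := arg_maxnP (fun x => #|neighbors x|) x0_two.
pose ls := rev (sort <=%R L).
have lsL : perm_eq ls L by rewrite perm_rev perm_sort.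
have [|||T T_lab T_inj] := exists_injective_labelling (ls := ls) r_two r_max.
- by rewrite (perm_size lsL).
- by rewrite rev_sorted sort_lt_sorted fset_uniq.
- by move=> l; rewrite (perm_mem lsL); apply: L_gt0.
apply: antimagic_of_oriented_labelling T_inj.
exact: oriented_labelling_perm T_lab.
Qed.
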